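(* Let $(X,d)$ be a metric space (not assumed complete) with $|X|\geqslant 3$, let $x^*\in X$, and let the mapping $T\colon X\to X$ satisfy the following four conditions: (i) $T$ does not possess periodic points of prime period $2$; (ii) $T$ is a generalized Chatterjea type mapping on $X$; (iii) $T$ is continuous at $x^*$; (iv) there exists a point $x_0\in X$ such that the sequence of iterates $x_n=Tx_{n-1}$, $n=1,2,\ldots$, has a subsequence $(x_{n_k})$ converging to $x^*$. Then $x^*$ is a fixed point of $T$, and the number of fixed points of $T$ is at most two.
   Context: For a metric space $(X,d)$ with $|X|\geqslant 3$, a mapping $T\colon X\to X$ is called a generalized Chatterjea type mapping on $X$ if there exists $\gamma\in[0,\frac13)$ such that $$d(Tx,Ty)+d(Ty,Tz)+d(Tx,Tz)\leqslant \gamma\,(d(x,Ty)+d(x,Tz)+d(y,Tx)+d(y,Tz)+d(z,Tx)+d(z,Ty))$$ holds for all three pairwise distinct points $x,y,z\in X$. A point $x\in X$ is a periodic point of prime period $2$ of $T$ if $T(Tx)=x$ and $Tx\neq x$. *)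

(* Defs.v *)
From mathcomp Require Import all_boot all_order all_algebra.
From mathcomp Require Import all_classical all_reals all_analysis.

Set Implicit Arguments.
Unset Strict Implicit.
Unset Printing Implicit Defensive.

Import Order.TTheory GRing.Theory Num.Theory.

Local Open Scope ring_scope.

Definition generalized_chatterjea (R : realType) (X : metricType R)
    (T : X -> X) : Prop :=
  exists gamma : R, 0 <= gamma < 3^-1 /\
    forall x y z : X, x <> y -> y <> z -> x <> z ->
      mdist (T x) (T y) + mdist (T y) (T z) + mdist (T x) (T z) <=
      gamma * (mdist x (T y) + mdist x (T z) + mdist y (T x)
               + mdist y (T z) + mdist z (T x) + mdist z (T y)).

Definition periodic_prime2 (X : Type) (T : X -> X) (x : X) : Prop :=
  T (T x) = x /\ T x <> x.

(* Main.v *)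
Require Import Defs.
From mathcomp Require Import all_boot all_order all_algebra.
From mathcomp Require Import all_classical all_reals all_analysis.
From mathcomp Require Import lra.

(** Without points of prime period 2, three consecutive iterates [x, T x, T (T x)]
    are either pairwise distinct or [d (T (T x)) (T (T (T x))) = 0]; in the first
    case the Chatterjea inequality on that triple halves the displacement in two
    steps, because [gamma / (1 - gamma) < 1 / 2].  Hence displacements tend to 0
    along every orbit, and continuity at a cluster point of the orbit makes that
    point fixed. *)

Local Open Scope classical_set_scope.
Local Open Scope card_scope.
Local Open Scope ring_scope.

Import Order.TTheory GRing.Theory Num.Theory.
Import numFieldNormedType.Exports metricType_numDomainType.

Section GeneralizedChatterjea.
Set Implicit Arguments.
Unset Strict Implicit.
Context (R : realType) (X : metricType R) (T : X -> X).
Hypothesis chatT : generalized_chatterjea T.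

(** For pairwise distinct fixed points with sum of mutual distances [s], each distance occurs twice
    on the right of the Chatterjea inequality, so [s <= 2 * gamma * s]. Since [2 * gamma < 1], this
    contradicts [s > 0]. *)
Lemma chatterjea_fixed_points (p q r : X) :
  T p = p -> T q = q -> T r = r -> [\/ p = q, q = r | p = r].
Proof.
move=> Tp Tq Tr; have [gamma [/andP[g0 g1] chat]] := chatT.
have [?|/eqP pq] := eqVneq p q; first exact: Or31.
have [?|/eqP qr] := eqVneq q r; first exact: Or32.
have [?|/eqP pr] := eqVneq p r; first exact: Or33.
have := chat _ _ _ pq qr pr; rewrite Tp Tq Tr.
rewrite (metric_sym q p) (metric_sym r p) (metric_sym r q).
have : 0 < mdist p q by rewrite mdist_gt0; exact/eqP.
clear pq qr pr Tp Tq Tr chat.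
have : 0 <= mdist p r := mdist_ge0 _ _.
have : 0 <= mdist q r := mdist_ge0 _ _.
set a := mdist p q; set b := mdist p r; set c := mdist q r => c0 b0 a0 chat3.
have : gamma * (a + b + c) <= 3^-1 * (a + b + c).
  by rewrite ler_wpM2r; lra.
lra.
Qed.

Lemma card_chatterjea_fixed_points : [set x : X | T x = x] #<= `I_2.
Proof.
have [->|/set0P[p Tp]] := eqVneq [set x : X | T x = x] set0.
  exact: card_ge0.
(* [q] is a second fixed point if there is one, and [p] itself otherwise; in both cases [p] and [q]
   exhaust the fixed points. *)
have [q [Tq pq]] : exists q, T q = q /\ forall r, T r = r -> r = p \/ r = q.
  have [[q Tq qp]|noq] := pselect (exists2 q, T q = q & q <> p).
    exists q; split=> // r Tr.
    by have [/esym|->|->] := chatterjea_fixed_points Tp Tq Tr; auto.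
  exists p; split=> // r Tr; left; apply: contrapT => rp.
  by apply: noq; exists r.
apply: card_le_trans (card_image_le (fun n => if n == 0%N then p else q) _).
apply: subset_card_le => r /= Tr.
by have [->|->] := pq r Tr; [exists 0%N | exists 1%N].
Qed.

Hypothesis no_period2 : ~ exists x : X, periodic_prime2 T x.

Lemma chatterjea_displacement (x : X) :
  mdist (T (T x)) (T (T (T x))) <= 2^-1 * mdist x (T x).
Proof.
have [gamma [/andP[g0 g1] chat]] := chatT.
have [xTx|/eqP xTx] := eqVneq x (T x); first by rewrite -!xTx mdistxx mulr0.
have [TTx|/eqP TTx] := eqVneq (T x) (T (T x)).
  by rewrite -!TTx mdistxx mulr_ge0// mdist_ge0.
have xTT : x <> T (T x).
  by move=> xTT; apply: no_period2; exists x; split=> // /esym.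
have := chat _ _ _ xTx TTx xTT; clear chat xTx TTx xTT.
set a := x; set b := T x; set c := T b; set e := T c.
rewrite (metric_sym c b) !mdistxx => chat3.
have ab0 := mdist_ge0 a b.
(* Distances from [a] are routed through [b], so that the right side involves only [mdist a b] and
   the sum [mdist b c + mdist b e], which also occurs on the left. *)
have ac : mdist a c <= mdist a b + mdist b c := metric_triangle _ _ _.
have ae : mdist a e <= mdist a b + mdist b e := metric_triangle _ _ _.
have ce : mdist c e <= mdist b c + mdist b e.
  by rewrite (metric_sym b c); exact: metric_triangle.
have ce0 := mdist_ge0 c e.
have bound : gamma * (mdist a c + mdist a e + 0 + mdist b e + mdist b c + 0) <=
    gamma * (2 * mdist a b + 2 * (mdist b c + mdist b e)).
  by rewrite ler_wpM2l//; lra.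
have gce : gamma * mdist a b <= 3^-1 * mdist a b by rewrite ler_wpM2r// ltW.
(* As [1 - 2 * gamma > 0], replacing the sum by the smaller [mdist c e] leaves [(2 - 2 * gamma) *
   mdist c e <= 2 * gamma * mdist a b]. Bounding [gamma] by 1/3 on both sides gives the factor
   1/2. *)
have : (1 - 2 * gamma) * mdist c e <=
    (1 - 2 * gamma) * (mdist b c + mdist b e) by rewrite ler_wpM2l//; lra.
have : gamma * mdist c e <= 3^-1 * mdist c e by rewrite ler_wpM2r// ltW.
lra.
Qed.

Lemma chatterjea_asymptotically_regular (x : X) :
  mdist (iter n T x) (iter n.+1 T x) @[n --> \oo] --> (0 : R).
Proof.
(* The halving takes two steps, so even and odd indices form separate chains; [C] dominates the
   first term of each. *)
pose C := mdist x (T x) + mdist (T x) (T (T x)).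
have C1 : mdist x (T x) <= C by rewrite lerDl mdist_ge0.
have C2 : mdist (T x) (T (T x)) <= C by rewrite lerDr mdist_ge0.
have even_odd m : mdist (iter m.*2 T x) (iter m.*2.+1 T x) <= C * 2^-1 ^+ m /\
    mdist (iter m.*2.+1 T x) (iter m.*2.+2 T x) <= C * 2^-1 ^+ m.
  elim: m => [|m [IH1 IH2]]; first by rewrite expr0 mulr1.
  rewrite doubleS exprS mulrCA; split.
    by apply: le_trans (chatterjea_displacement _) _; rewrite ler_pM2l.
  by apply: le_trans (chatterjea_displacement _) _; rewrite ler_pM2l.
have bound n : mdist (iter n T x) (iter n.+1 T x) <= C * 2^-1 ^+ n./2.
  rewrite -{1 2}(odd_double_half n).
  by case: (odd n); have [] := even_odd n./2.
apply: (@squeeze_cvgr _ _ _ _ (fun=> 0) (geometric C 2^-1 \o half)).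
- by apply: nearW => n; rewrite mdist_ge0 bound.
- exact: cvg_cst.
- apply: (cvg_comp half (geometric C 2^-1)); last first.
    by apply: cvg_geometric; rewrite ger0_norm; lra.
  apply/cvgnyPge => A; near=> n.
  rewrite -(doubleK A) half_leq//; near: n; exact: nbhs_infty_ge.
Unshelve. all: by end_near. Qed.

End GeneralizedChatterjea.

(** The path [l], [u n], [T (u n)], [T l] has three legs that tend to 0: by convergence of [u], by
    the vanishing displacement and by continuity at [l]. *)
Lemma fixed_of_displacement_cvg0 {R : realType} {X : metricType R}
    {T : X -> X} {u : nat -> X} {l : X} :
  {for l, continuous T} -> u @ \oo --> l ->
  mdist (u n) (T (u n)) @[n --> \oo] --> (0 : R) -> T l = l.
Proof.
move=> Tl ul du.
have Tul : T (u n) @[n --> \oo] --> T l by exact: continuous_cvg.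
apply/esym/mdist_positivity/eqP; rewrite eq_le mdist_ge0 andbT.
apply/ler_addgt0Pr => e e0; rewrite add0r.
have e3 : 0 < e / 3 by lra.
have : \forall n \near \oo, mdist l (T l) <= e.
  near=> n.
  have h1 : mdist l (u n) < e / 3 by near: n; exact: cvgr_dist_lt.
  have h2 : mdist (T l) (T (u n)) < e / 3 by near: n; exact: cvgr_dist_lt.
  have h3 : mdist (u n) (T (u n)) < e / 3 by near: n; exact: cvgr_lt du _ e3.
  have := metric_triangle l (u n) (T l).
  have := metric_triangle (u n) (T (u n)) (T l).
  by rewrite (metric_sym (T (u n)) (T l)); lra.
by move=> /filter_ex[].
Unshelve. all: by end_near. Qed.

Theorem theorem4p1 (R : realType) (X : metricType R)
  (cardX : `I_3 #<= [set: X]) (xs : X) (T : X -> X)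
  (no_period2 : ~ exists x : X, periodic_prime2 T x)
  (chatT : generalized_chatterjea T)
  (contT : {for xs, continuous T})
  (subseq_cvg : exists (x0 : X) (n_ : nat -> nat),
     (forall i j : nat, (i < j)%N -> (n_ i < n_ j)%N) /\
     (fun k : nat => iter (n_ k) T x0) @ \oo --> xs) :
  T xs = xs /\ [set x : X | T x = x] #<= `I_2.
Proof.
split; last exact: card_chatterjea_fixed_points.
have [x0 [n_ [n_incr x_cvg]]] := subseq_cvg.
apply: (fixed_of_displacement_cvg0 contT x_cvg).
(* A strictly increasing index sequence tends to infinity, so the displacement limit along the whole
   orbit passes to the subsequence. *)
have n_ge k : (k <= n_ k)%N.
  by elim: k => // k /leq_ltn_trans; apply; exact: n_incr.
have n_cvg : n_ @ \oo --> \oo.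
  apply/cvgnyPge => A; near=> k.
  by apply: leq_trans (n_ge k); near: k; exact: nbhs_infty_ge.
exact: (cvg_comp n_ _ n_cvg (chatterjea_asymptotically_regular chatT no_period2 x0)).
Unshelve. all: by end_near. Qed.
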